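(* Let $G$ be a graph with $n$ vertices. Let $N=\{i_1j_1,\ldots,i_kj_k\}$ be a dominating induced matching of $G$, where $2k\le n-1$, and let $X=V(N)$. Then $$S_L(G)\ \ge\ \alpha_X-1 .$$ If equality holds, then there are integers $s$ and $t$ such that each vertex in $X$ is adjacent to $s$ vertices in $X^c$, each vertex in $X^c$ is adjacent to $t$ vertices in $X$, and $s|X|=t|X^c|$; moreover, $\rho_G(V(N))=\mu_1$ and $\frac{1}{n-2k}\sum_{v\in V(N)^c}d(v)=a(G)$.
   Context: Graphs are finite, simple and undirected. For a graph $G$ with $n$ vertices, $L(G)=D(G)-A(G)$ is the Laplacian matrix ($D(G)$ the diagonal matrix of vertex degrees, $A(G)$ the adjacency matrix), with eigenvalues $\mu_1\ge\dots\ge\mu_{n-1}\ge\mu_n=0$. The algebraic connectivity is $a(G)=\mu_{n-1}$ and the Laplacian spread is $S_L(G)=\mu_1-a(G)$. $d(v)$ is the degree of $v$. For a nonempty proper subset $X$ of $V(G)$, $X^c=V(G)\setminus X$, $E_X(G)$ is the set of edges with one end in $X$ and the other in $X^c$, the edge density is $\rho_G(X)=\dfrac{n|E_X(G)|}{|X||X^c|}$, and $\alpha_X=\frac{1}{|X|}\sum_{v\in X}d(v)$. A matching is a nonempty set of edges no two of which share a vertex. A matching $N$ is a dominating induced matching (DIM) if every edge of $G$ is either in $N$ or shares an end vertex with exactly one edge of $N$. Here $N$ consists of the $k$ edges $i_1j_1,\ldots,i_kj_k$, and $V(N)$ is the set of end vertices of the edges of $N$.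
   Formalization: The formal theorem assumes in addition that G is not a complete graph; this excludes only G = K_3 with N a single edge, where the inequality fails since S_L = 0 while α_X − 1 = 1. *)

(* Defs.v *)
(* A finite simple undirected graph is a symmetric irreflexive relation [e] on
   a finite type [T] of vertices; an edge is a two-element set of vertices. *)
From mathcomp Require Import all_boot all_order all_algebra.
From mathcomp Require Import polyrcf.

Set Implicit Arguments.
Unset Strict Implicit.
Unset Printing Implicit Defensive.

Import Order.TTheory GRing.Theory Num.Theory.
Local Open Scope ring_scope.

(* Real eigenvalues of A, repeated with algebraic multiplicity and sorted in
   nonincreasing order. For symmetric A this is the whole spectrum. *)
Definition spectrum (R : rcfType) (n : nat) (A : 'M[R]_n) : seq R :=
  sort >=%R
    (flatten [seq nseq (mup x (char_poly A)) x | x <- rootsR (char_poly A)]).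

Section Graph.

Variables (T : finType) (e : rel T).

Definition edges : {set {set T}} :=
  [set f | [exists x, exists y, e x y && (f == [set x; y])]].

Definition deg (v : T) : nat := #|[set w | e v w]|.

Definition complete : Prop := forall x y : T, x != y -> e x y.

(* For edges, "pairwise disjoint" is "no two share a vertex". *)
Definition matching (N : {set {set T}}) : Prop :=
  [/\ N != set0, N \subset edges & trivIset N].

Definition dominating_induced_matching (N : {set {set T}}) : Prop :=
  matching N /\
  forall f : {set T}, f \in edges ->
    f \in N \/ #|[set g in N | f :&: g != set0]| = 1%N.

Definition edge_boundary (X : {set T}) : {set {set T}} :=
  [set f in edges | [exists x in X, exists y in ~: X, f == [set x; y]]].

Variable R : rcfType.

Definition adjacency_mx : 'M[R]_#|T| :=
  \matrix_(i, j) (e (enum_val i) (enum_val j))%:R.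

Definition degree_mx : 'M[R]_#|T| :=
  diag_mx (\row_i (deg (enum_val i))%:R).

Definition laplacian : 'M[R]_#|T| := degree_mx - adjacency_mx.

(* [mu i] is the i-th largest eigenvalue, counting from i = 1. *)
Definition mu (i : nat) : R := (spectrum laplacian)`_i.-1.

Definition algebraic_connectivity : R := mu #|T|.-1.

Definition laplacian_spread : R := mu 1 - algebraic_connectivity.

Definition edge_density (X : {set T}) : R :=
  (#|T|%:R * #|edge_boundary X|%:R) / (#|X|%:R * #|~: X|%:R).

Definition avg_degree (X : {set T}) : R :=
  (#|X|%:R)^-1 * \sum_(v in X) (deg v)%:R.

End Graph.

(* Main.v *)
Require Import Defs.
From mathcomp Require Import all_boot all_order all_algebra all_fingroup.
From mathcomp Require Import polyrcf complex spectral.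
From mathcomp Require Import zify ring lra.

Set Implicit Arguments.
Unset Strict Implicit.
Unset Printing Implicit Defensive.

Import Order.TTheory GRing.Theory Num.Theory.
Local Open Scope ring_scope.
Local Open Scope sesquilinear_scope.

(** Write X = V(N), and let p = |X|, q = |X^c|, m = |E_X| and n = p + q.

    Because N dominates every edge exactly once, X induces the perfect matching
    N and X^c is independent ([degree_in_cover], [degree_in_coverC]).  So every
    vertex of X has exactly one neighbour that does not count for m, and all
    edges at X^c count for m: alpha_X - 1 = m / p, and the average degree on
    X^c is m / q.  Since rho(X) = n m / (p q) = m / p + m / q, this gives

        alpha_X - 1 = rho(X) - (average degree on X^c),

    and the inequality follows from two bounds of independent interest:

    - rho(X) <= mu_1 ([edge_density_le_mu1]).  The function equal to q on X and
      to -p on X^c has Rayleigh quotient rho(X).  If rho(X) = mu_1, then it is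
      an eigenfunction of the Laplacian, and reading the eigenvalue equation at
      each vertex gives the two regularity numbers s and t
      ([edge_density_eq_mu1]).
    - a(G) <= d(v) for every vertex v of a graph that is not complete
      ([algebraic_connectivity_le_deg], due to Fiedler); averaging over X^c
      gives a(G) <= m / q.

    Equality in the theorem forces equality in both bounds.

    The variational facts about mu_1 and mu_(n-1) come from the unitary
    diagonalisation of the Laplacian over the complex extension R[i]
    ([symmetric_spectral]).  Its eigenvalues are real, hence the characteristic
    polynomial splits over R and its roots, with multiplicity, are exactly the
    entries of [spectrum].  Real scalar products are Hermitian products of the
    complex eigencoordinates ([spectral_coordinates]), so the Rayleigh quotient
    of a real vector is a weighted mean of the real eigenvalues. *)

(** * The spectrum of a real symmetric matrix *)

(** Over a field where the characteristic polynomial splits, counting roots with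
    multiplicity recovers the multiset of its linear factors. *)
Lemma spectrum_char_poly (R : rcfType) n (A : 'M[R]_n) (s : seq R) :
  char_poly A = \prod_(x <- s) ('X - x%:P) -> spectrum A = sort >=%R s.
Proof.
move=> chA; rewrite /spectrum chA; apply/perm_sortP.
- by move=> x y; apply: ge_total.
- by apply: rev_trans; apply: le_trans.
- by move=> x y /le_anti.
apply/allP => x _ /=; apply/eqP.
set p := \prod_(y <- s) _.
have p0 : p != 0 by rewrite monic_neq0 // monic_prod_XsubC.
rewrite count_flatten -map_comp.
have root_x : (x \in rootsR p) = (x \in s).
  by rewrite -(roots_on_rootsR p0) in_itv /= root_prod_XsubC.
under eq_map => y do rewrite /= count_nseq /= mu_prod_XsubC.
rewrite sumnE big_map; have [xs|xs] := boolP (x \in s); last first.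
  rewrite (count_memPn xs) big_seq big1 // => y.
  by case: eqVneq => [->|//]; rewrite root_x (negPf xs).
rewrite (bigD1_seq x) /= ?root_x ?uniq_roots // eqxx mul1n big1 ?addn0 //.
by move=> y /negPf ->.
Qed.

Lemma char_poly_conjugate (F : fieldType) n (V D : 'M[F]_n) : V \in unitmx ->
  char_poly (invmx V *m D *m V) = char_poly D.
Proof.
move=> uV; rewrite /char_poly.
have VK : map_mx polyC (invmx V) *m map_mx polyC V = 1%:M.
  by rewrite -map_mxM mulVmx // map_mx1.
have -> : char_poly_mx (invmx V *m D *m V) =
    map_mx polyC (invmx V) *m char_poly_mx D *m map_mx polyC V.
  rewrite /char_poly_mx mulmxBr mulmxBl scalar_mxC.
  by rewrite -['X%:M *m _ *m _]mulmxA VK mulmx1 !map_mxM.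
by rewrite !det_mulmx mulrAC -det_mulmx VK det1 mul1r.
Qed.

(** The spectral theorem over R[i] gives eigenvalues in an unspecified order; a
    permutation matrix moves them into the nonincreasing order of [spectrum]. *)
Lemma symmetric_spectral (R : rcfType) n (A : 'M[R]_n) : A^T = A ->
  size (spectrum A) = n /\
  exists2 P : 'M[R[i]%C]_n, P \is unitarymx &
    map_mx (real_complex R) A =
      P^t* *m diag_mx (\row_j ((spectrum A)`_j)%:C%C) *m P.
Proof.
move=> symA; set B := map_mx _ A.
have hermB : B \is hermsymmx.
  apply: realsym_hermsym.
    by apply/is_hermitianmxP; rewrite expr0 scale1r map_mx_id // /B map_trmx symA.
  by apply/mxOverP => i j; rewrite mxE; apply/complex_realP; exists (A i j).
have /orthomx_spectralP := hermitian_normalmx hermB.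
set Q := spectralmx B; set c := spectral_diag B => eqB.
have Qu : Q \is unitarymx by apply: spectral_unitarymx.
rewrite invmx_unitary // in eqB.
pose d := [tuple complex.Re (c 0 i) | i < n].
have cE i : c 0 i = (tnth d i)%:C%C.
  rewrite tnth_mktuple RRe_real //.
  by have /mxOverP := hermitian_spectral_diag_real hermB.
have chA : char_poly A = \prod_(x <- d) ('X - x%:P).
  apply: (@map_poly_inj _ _ (real_complex R)).
  rewrite map_char_poly -/B eqB -invmx_unitary // char_poly_conjugate ?unitarymx_unit //.
  rewrite char_poly_trig ?diag_mx_is_trig // big_map rmorph_prod -big_enum /=.
  apply: eq_bigr => i _ /=.
  by rewrite mxE eqxx cE tnth_mktuple rmorphB /= map_polyX map_polyC.
have spE : spectrum A = sort >=%R d by apply: spectrum_char_poly.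
split; first by rewrite spE size_sort size_tuple.
have : perm_eq (sort >=%R d) d by rewrite perm_sort.
case/tuple_permP => p pE.
have spj (j : 'I_n) : (spectrum A)`_j = tnth d (p j).
  by rewrite spE pE -tnth_nth tnth_mktuple.
pose S : 'M[R[i]%C]_n := perm_mx p.
have Su : S \is unitarymx.
  apply/unitarymxP; rewrite tr_perm_mx map_perm_mx -perm_mxM.
  by rewrite mulgV perm_mx1.
have sC : diag_mx c = S^t* *m diag_mx (\row_j ((spectrum A)`_j)%:C%C) *m S.
  rewrite tr_perm_mx map_perm_mx -row_permE /S -[in perm_mx p](invgK p) -col_permE.
  by apply/matrixP => i j; rewrite !mxE (inj_eq perm_inj) spj permKV cE.
exists (S *m Q); first exact: mul_unitarymx.
by rewrite eqB sC trmx_mul map_mxM !mulmxA.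
Qed.

(** [y x] lists the coordinates of the real vector [x] in an orthonormal complex
    eigenbasis: the scalar product is preserved, and [A] acts diagonally. *)
Lemma spectral_coordinates (R : rcfType) n (A : 'M[R]_n) : A^T = A ->
  exists y : 'rV[R]_n -> 'I_n -> R[i]%C,
    (forall x z, ((x *m z^T) 0 0)%:C%C = \sum_j y x j * (y z j)^*) /\
    (forall x j, y (x *m A) j = ((spectrum A)`_j)%:C%C * y x j).
Proof.
move=> /symmetric_spectral[_ [P Pu AE]].
exists (fun x j => (map_mx (real_complex R) x *m P^t*) 0 j); split=> [x z | x j].
  transitivity ((map_mx (real_complex R) x *m P^t* *m
                (map_mx (real_complex R) z *m P^t*)^t*) 0 0).
    rewrite trmx_mul map_mxM trmxCK mulmxA mulmxKtV //.
    have -> : (map_mx (real_complex R) z)^t* = map_mx (real_complex R) z^T.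
      by apply/matrixP => i j; rewrite !mxE; apply: conjc_real.
    by rewrite -map_mxM [RHS]mxE.
  by rewrite mxE; apply: eq_bigr => j _; rewrite !mxE.
rewrite map_mxM AE !mulmxA mulmxtVK // mul_mx_diag !mxE mulrC.
by congr (_ * _).
Qed.

Lemma spectrum_sorted (R : rcfType) n (A : 'M[R]_n) i j : A^T = A ->
  (i <= j < n)%N -> (spectrum A)`_j <= (spectrum A)`_i.
Proof.
move=> /symmetric_spectral[sz _] /andP[ij jn].
apply: (@sorted_leq_nth _ >=%R) => //; rewrite ?inE ?sz //.
- by apply: rev_trans; apply: le_trans.
- exact: ge_refl.
- by apply: sort_sorted => x y; apply: ge_total.
- exact: leq_ltn_trans jn.
Qed.

(** In eigencoordinates the gap between the two sides is the sum of
    (s_0 - s_j) |y_j|^2.  If it vanishes, then y_j = 0 unless s_j = s_0, so x lies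
    in the eigenspace of s_0. *)
Lemma spectrum_max_rayleigh (R : rcfType) n (A : 'M[R]_n) (x : 'rV[R]_n) :
  A^T = A ->
  (x *m A *m x^T) 0 0 <= (spectrum A)`_0 * (x *m x^T) 0 0 /\
  ((x *m A *m x^T) 0 0 = (spectrum A)`_0 * (x *m x^T) 0 0 ->
   x *m A = (spectrum A)`_0 *: x).
Proof.
move=> symA; have [y [yD yA]] := spectral_coordinates symA.
have gap (z : 'rV_n) :
    ((spectrum A)`_0 * (x *m z^T) 0 0 - (x *m A *m z^T) 0 0)%:C%C =
    \sum_(j < n) ((spectrum A)`_0 - (spectrum A)`_j)%:C%C * y x j * (y z j)^*.
  rewrite rmorphB rmorphM /= !yD mulr_sumr -sumrB; apply: eq_bigr => j _.
  by rewrite yA rmorphB /= !mulrBl mulrA.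
have ge0 (j : 'I_n) :
    0 <= ((spectrum A)`_0 - (spectrum A)`_j)%:C%C * y x j * (y x j)^*.
  rewrite -mulrA mulr_ge0 ?mul_conjC_ge0 //.
  by rewrite ler0c subr_ge0 spectrum_sorted /=.
split; first by rewrite -subr_ge0 -ler0c gap sumr_ge0.
move=> eqx; have /eqP := gap x; rewrite eqx subrr eq_sym psumr_eq0 //.
move=> /allP /= y0; apply/esym/eqP; rewrite -subr_eq0; apply/eqP/rowP => k.
(* Testing the gap against the k-th unit vector reads off the k-th entry. *)
have := gap (delta_mx 0 k); rewrite big1 => [|j _].
  rewrite trmx_delta -!colE !mxE.
  by move/complexI.
have := y0 j; rewrite mem_index_enum => /(_ isT); rewrite -mulrA.
rewrite mulf_eq0 mul_conjC_eq0 => /orP[] /eqP ->; first by rewrite !mul0r.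
by rewrite mulr0 mul0r.
Qed.

(** The case n - 1 of the Courant-Fischer principle, for a positive semidefinite
    matrix with a known kernel vector [v].  If the second smallest eigenvalue is
    positive, then [v] spans the kernel, so a vector orthogonal to [v] has no
    component on the smallest eigenvalue. *)
Lemma spectrum_second_min_rayleigh (R : rcfType) n (A : 'M[R]_n)
    (v x : 'rV[R]_n) :
  A^T = A -> (forall z : 'rV_n, 0 <= (z *m A *m z^T) 0 0) ->
  v != 0 -> v *m A = 0 -> x *m v^T = 0 ->
  (spectrum A)`_n.-2 * (x *m x^T) 0 0 <= (x *m A *m x^T) 0 0.
Proof.
move=> symA psdA v0 vA xv; have [y [yD yA]] := spectral_coordinates symA.
have n2 (j : 'I_n) : (n.-2 < n)%N by case: j => i; case: (n) => [|[|m]].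
set a := _`_n.-2; have [a_le0|a_gt0] := lerP a 0.
  apply: le_trans (psdA x); rewrite mulr_le0_ge0 // mxE sumr_ge0 // => j _.
  by rewrite mxE -expr2 sqr_ge0.
have yv (j : 'I_n) : (j <= n.-2)%N -> y v j = 0.
  move=> jn; have := yA v j.
  (* v *m A = 0, so its coordinates have squared norm 0. *)
  have -> : y (v *m A) j = 0.
    have /eqP := yD (v *m A) (v *m A); rewrite vA mul0mx mxE eq_sym psumr_eq0.
      move=> /allP /(_ j); rewrite mem_index_enum => /(_ isT) /=.
      by rewrite mul_conjC_eq0 => /eqP.
    by move=> i _; rewrite mul_conjC_ge0.
  have sj : 0 < (spectrum A)`_j.
    apply: lt_le_trans a_gt0 _; apply: spectrum_sorted => //.
    by rewrite jn n2.
  move/esym/eqP; rewrite mulf_eq0 => /orP[|/eqP //].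
  by rewrite -(rmorph0 (real_complex R)) (inj_eq (@complexI R)) (gt_eqF sj).
(* Orthogonality leaves the product of the last coordinates of v and x, and the
   last coordinate of v is its only nonzero one. *)
have yx (j : 'I_n) : (n.-2 < j)%N -> y x j = 0.
  move=> jn; have others (i : 'I_n) : i != j -> y v i = 0.
    move=> ij; apply: yv; rewrite leqNgt; apply: contra ij => i_n.
    by rewrite -val_eqE /=; have := ltn_ord i; have := ltn_ord j; lia.
  have yvj : y v j != 0.
    apply: contra v0 => /eqP yvj.
    have /complexI vv0 : ((v *m v^T) 0 0)%:C%C = 0%:C%C.
      rewrite yD big1 // => i _.
      by have [->|/others ->] := eqVneq i j; rewrite ?yvj mul0r.
    have /eqP := vv0; rewrite mxE psumr_eq0 => [/allP /= v_i|i _]; last first.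
      by rewrite mxE -expr2 sqr_ge0.
    apply/eqP/rowP => i; have := v_i i; rewrite mem_index_enum => /(_ isT).
    by rewrite !mxE mulf_eq0 orbb => /eqP.
  have /eqP := yD x v; rewrite xv mxE (bigD1 j) //= big1 ?addr0.
    by rewrite eq_sym mulf_eq0 conjC_eq0 (negPf yvj) orbF => /eqP.
  by move=> i /others ->; rewrite conjC0 mulr0.
rewrite -lecR rmorphM /= !yD mulr_sumr; apply: ler_sum => j _.
have [jn|jn] := leqP j n.-2; last by rewrite yA yx // !(mulr0, mul0r).
rewrite yA -mulrA ler_wpM2r ?mul_conjC_ge0 // lecR spectrum_sorted //.
by rewrite jn n2.
Qed.

(** * The Laplacian as an operator on functions of the vertices *)

Section LaplacianForm.

Variables (R : rcfType) (T : finType) (e : rel T).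
Hypotheses (e_sym : symmetric e) (e_irr : irreflexive e).

Definition lap (f : T -> R) (v : T) : R := \sum_(w | e v w) (f v - f w).

Definition vec (f : T -> R) : 'rV[R]_#|T| := \row_i f (enum_val i).

Lemma dot_vec f g : (vec f *m (vec g)^T) 0 0 = \sum_v f v * g v.
Proof.
rewrite mxE [RHS](reindex _ (onW_bij _ (enum_val_bij T))) /=.
by apply: eq_bigr => i _; rewrite !mxE.
Qed.

Lemma lapE f v : lap f v = (deg e v)%:R * f v - \sum_w (e v w)%:R * f w.
Proof.
rewrite /lap sumrB sumr_const mulr_natl /deg cardsE; congr (_ - _).
rewrite [LHS]big_mkcond; apply: eq_bigr => w _.
by case: (e v w); rewrite ?mul1r ?mul0r.
Qed.

Lemma laplacian_sym : (laplacian e R)^T = laplacian e R.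
Proof.
rewrite /laplacian linearB /= tr_diag_mx; congr (_ - _).
by apply/matrixP => i j; rewrite !mxE e_sym.
Qed.

Lemma vec_laplacian f : vec f *m laplacian e R = vec (lap f).
Proof.
rewrite mulmxBr mul_mx_diag; apply/rowP => j; rewrite !mxE lapE; congr (_ - _).
  by rewrite mulrC.
rewrite [RHS](reindex _ (onW_bij _ (enum_val_bij T))) /=.
by apply: eq_bigr => i _; rewrite !mxE mulrC e_sym.
Qed.

Lemma laplacian_form f :
  (vec f *m laplacian e R *m (vec f)^T) 0 0 = \sum_v f v * lap f v.
Proof. by rewrite vec_laplacian dot_vec; under eq_bigr do rewrite mulrC. Qed.

(** Twice the form is the sum of the squares (f v - f w)^2 over all ordered pairs
    of adjacent vertices. *)
Lemma laplacian_form_ge0 f : 0 <= \sum_v f v * lap f v.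
Proof.
have eqD : \sum_v f v * lap f v = \sum_v \sum_(w | e v w) f v * (f v - f w).
  by apply: eq_bigr => v _; rewrite mulr_sumr.
have eqD' : \sum_v f v * lap f v = \sum_v \sum_(w | e v w) f w * (f w - f v).
  rewrite eqD (exchange_big_dep xpredT) //=.
  by apply: eq_bigr => v _; apply: eq_bigl => w; rewrite e_sym.
rewrite -(pmulrn_lge0 _ (ltn0Sn 1)) mulr2n {1}eqD eqD' -big_split sumr_ge0 //=.
move=> v _; rewrite -big_split sumr_ge0 //= => w _.
suff -> : f v * (f v - f w) + f w * (f w - f v) = (f v - f w) ^+ 2.
  exact: sqr_ge0.
by ring.
Qed.

Lemma mu1_rayleigh f :
  \sum_v f v * lap f v <= mu e R 1 * \sum_v f v ^+ 2 /\
  (\sum_v f v * lap f v = mu e R 1 * \sum_v f v ^+ 2 ->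
   forall v, lap f v = mu e R 1 * f v).
Proof.
have [le1 eq1] := spectrum_max_rayleigh (vec f) laplacian_sym.
have nrm : (vec f *m (vec f)^T) 0 0 = \sum_v f v ^+ 2 by rewrite dot_vec.
rewrite laplacian_form nrm in le1 eq1; split=> // /eq1.
rewrite vec_laplacian => /rowP eqf v.
by have := eqf (enum_rank v); rewrite !mxE enum_rankK.
Qed.

(** The constant functions lie in the kernel of the Laplacian, so functions of
    sum zero are the test functions for the second smallest eigenvalue. *)
Lemma algebraic_connectivity_rayleigh f : \sum_v f v = 0 ->
  algebraic_connectivity e R * \sum_v f v ^+ 2 <= \sum_v f v * lap f v.
Proof.
move=> f0; have [w _|T0] := pickP (mem T); last first.
  by rewrite !big_pred0 ?mulr0.
have nrm : (vec f *m (vec f)^T) 0 0 = \sum_v f v ^+ 2 by rewrite dot_vec.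
rewrite -nrm -laplacian_form.
apply: (@spectrum_second_min_rayleigh _ _ _ (vec (fun=> 1))).
- exact: laplacian_sym.
- move=> z; have -> : z = vec (fun v => z 0 (enum_rank v)).
    by apply/rowP => i; rewrite mxE enum_valK.
  by rewrite laplacian_form laplacian_form_ge0.
- by apply/eqP => /rowP /(_ (enum_rank w)) /eqP; rewrite !mxE oner_eq0.
- rewrite vec_laplacian; apply/rowP => i; rewrite !mxE /lap big1 // => v _.
  exact: subrr.
- apply/matrixP => i j; rewrite !ord1 dot_vec mxE -[RHS]f0.
  by apply: eq_bigr => v _; rewrite mulr1.
Qed.

(** Let B be the set of vertices that are neither u nor adjacent to u, and let
    b = |B|.  The function equal to b at u, to -1 on B and to 0 on the neighbours
    of u has squared norm b (b + 1); each neighbour of u contributes at most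
    b^2 + b to its Laplacian form. *)
Lemma algebraic_connectivity_le_nonuniversal u x : x != u -> ~~ e u x ->
  algebraic_connectivity e R <= (deg e u)%:R.
Proof.
move=> xu eux.
pose B := [set w | (w != u) && ~~ e u w].
have uB : u \notin B by rewrite inE eqxx.
have b_gt0 : 0 < #|B|%:R :> R.
  by rewrite ltr0n; apply/card_gt0P; exists x; rewrite inE xu.
set b : R := #|B|%:R in b_gt0.
pose f w : R := if w == u then b else if w \in B then -1 else 0.
have sum_f (g : T -> R) : \sum_w f w * g w = b * g u - \sum_(w in B) g w.
  rewrite (bigD1 u) //= {1}/f eqxx; congr (_ + _).
  rewrite -sumrN [in RHS]big_mkcond [in RHS](bigD1 u) //= (negPf uB) add0r.
  apply: eq_bigr => w /negPf wu; rewrite /f wu; case: ifP => _.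
    by rewrite mulN1r.
  by rewrite mul0r.
have f0 : \sum_w f w = 0.
  under eq_bigr do rewrite -[f _]mulr1.
  by rewrite sum_f mulr1 sumr_const subrr.
have f2 : \sum_w f w ^+ 2 = b * (b + 1).
  under eq_bigr do rewrite expr2.
  rewrite sum_f {1}/f eqxx mulrDr; congr (_ + _).
  rewrite -sumrN (eq_bigr (fun=> 1)) ?sumr_const ?mulr1 // => w wB.
  by rewrite /f wB; case: eqP wB => [->|_ _]; rewrite ?(negPf uB) ?opprK.
have lapu : lap f u = (deg e u)%:R * b.
  rewrite lapE {1}/f eqxx big1 ?subr0 // => w _.
  rewrite /f; case: eqP => [->|wu]; first by rewrite e_irr mul0r.
  by rewrite inE; case: (e u w); rewrite ?andbF ?mulr0 ?mul0r.
(* A vertex of B is adjacent to vertices of B, where f has the same value, and to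
   neighbours of u, where f is larger by 1. *)
have lapB w : w \in B -> - lap f w <= \sum_(x | e u x) (e w x)%:R.
  move=> wB; rewrite /lap -sumrN [leRHS]big_mkcond [leLHS]big_mkcond.
  apply: ler_sum => y _.
  rewrite {1}/f wB; case: eqP wB => [->|_ wB]; first by rewrite (negPf uB).
  rewrite /f inE; case: eqP => [->|yu] /=.
    move: wB; rewrite inE e_sym => /andP[_ /negPf ->].
    by rewrite e_irr.
  by case: (e w y); case: (e u y); rewrite /=; lra.
have := algebraic_connectivity_rayleigh f0.
rewrite f2 sum_f lapu => le_a.
have: - \sum_(w in B) lap f w <= (deg e u)%:R * b.
  rewrite -sumrN; apply: le_trans (ler_sum _ lapB) _.
  rewrite exchange_big /= mulr_natl /deg cardsE -sumr_const.
  apply: ler_sum => y _; rewrite /b -sumr_const; apply: ler_sum => w _.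
  by case: (e w y).
move=> le_sum.
rewrite -(ler_pM2r (_ : 0 < b * (b + 1))) ?mulr_gt0 ?addr_gt0 //.
by apply: le_trans le_a _; rewrite mulrDr; nra.
Qed.

(** A vertex adjacent to all others has the largest possible degree, so the bound
    at any vertex that is not of this kind is stronger. *)
Lemma algebraic_connectivity_le_deg v : ~ complete e ->
  algebraic_connectivity e R <= (deg e v)%:R.
Proof.
move=> ncomp.
have [/existsP[x /andP[xv evx]]|/existsPn univ] :=
    boolP [exists x, (x != v) && ~~ e v x].
  by apply: algebraic_connectivity_le_nonuniversal xv evx.
have [/existsP[x /existsP[y /andP[xy exy]]]|/existsPn comp] :=
    boolP [exists x, exists y, (y != x) && ~~ e x y].
  have le_dx : (deg e x <= deg e v)%N.
    have -> : deg e v = #|T|.-1.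
      rewrite -(cardC1 v); apply: eq_card => w; rewrite !inE.
      have := univ w; rewrite negb_and !negbK.
      by case: eqP => [->|_ /= ->//]; rewrite e_irr.
    rewrite -(cardC1 x); apply/subset_leq_card/subsetP => w; rewrite !inE.
    by apply: contraL => /eqP ->; rewrite e_irr.
  apply: le_trans (algebraic_connectivity_le_nonuniversal xy exy) _.
  by rewrite ler_nat.
case: ncomp => x y xy; have /existsPn /(_ y) := comp x.
by rewrite negb_and !negbK eq_sym (negPf xy).
Qed.

End LaplacianForm.

(** * The cut between a vertex set and its complement *)

Section DegreeIn.

Variables (T : finType) (e : rel T).

Definition degree_in (A : {set T}) (v : T) : nat := #|[set w in A | e v w]|.

Lemma degree_inE (R : rcfType) (A : {set T}) v :
  (degree_in A v)%:R = \sum_(w in A | e v w) 1 :> R.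
Proof. by rewrite sumr_const /degree_in cardsE. Qed.

Lemma deg_split (A : {set T}) v : deg e v = (degree_in A v + degree_in (~: A) v)%N.
Proof.
rewrite /deg -(cardsID A); congr (_ + _)%N; apply: eq_card => w; rewrite !inE.
  exact: andbC.
by [].
Qed.

End DegreeIn.

Section Cut.

Variables (T : finType) (e : rel T).
Hypothesis e_sym : symmetric e.

(** A boundary edge is determined by its end in X and its end outside X. *)
Lemma card_edge_boundary (X : {set T}) :
  #|edge_boundary e X| = (\sum_(v in X) degree_in e (~: X) v)%N.
Proof.
pose D := [set p : T * T | [&& p.1 \in X, p.2 \in ~: X & e p.1 p.2]].
have -> : edge_boundary e X = [set [set p.1; p.2] | p in D].
  apply/setP => f; apply/idP/imsetP => [|[[x y]]].
    rewrite inE => /andP[f_e /existsP[x /andP[xX /existsP[y /andP[yX /eqP fE]]]]].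
    exists (x, y); last by [].
    rewrite inE /= xX yX /=; move: f_e; rewrite inE.
    case/existsP => u /existsP[v /andP[euv /eqP fE']].
    have xuv : x \in [set u; v] by rewrite -fE' fE set21.
    have yuv : y \in [set u; v] by rewrite -fE' fE set22.
    move: xuv yuv; rewrite !inE => /orP[] /eqP xE /orP[] /eqP yE.
    - by move: yX; rewrite inE yE -xE xX.
    - by rewrite xE yE.
    - by rewrite xE yE e_sym.
    - by move: yX; rewrite inE yE -xE xX.
  rewrite inE /= => /and3P[xX yX exy] ->; rewrite !inE; apply/andP; split.
    by apply/existsP; exists x; apply/existsP; exists y; rewrite exy eqxx.
  by apply/existsP; exists x; rewrite xX; apply/existsP; exists y; rewrite yX eqxx.
rewrite card_in_imset => [|[x y] [x' y']]; last first.
  rewrite !inE /= => /and3P[xX yX _] /and3P[x'X y'X _] eqf.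
  have : x \in [set x'; y'] by rewrite -eqf set21.
  have : y \in [set x'; y'] by rewrite -eqf set22.
  rewrite !inE => /orP[] /eqP yE /orP[] /eqP xE; subst => //.
  - by rewrite x'X in yX.
  - by rewrite x'X in yX.
  - by rewrite xX in y'X.
pose adj x y := (y \in ~: X) && e x y.
rewrite -sum1_card (eq_bigl (fun p : T * T => (p.1 \in X) && adj p.1 p.2)).
  rewrite -(pair_big_dep (mem X) adj (fun _ _ => 1%N)) /=.
  by apply: eq_bigr => x _; rewrite sum1_card /degree_in cardsE.
by move=> p; rewrite inE.
Qed.

Lemma edge_boundaryC (X : {set T}) : edge_boundary e (~: X) = edge_boundary e X.
Proof.
have sub (Y : {set T}) : edge_boundary e (~: Y) \subset edge_boundary e Y.
  apply/subsetP => f; rewrite !inE => /andP[-> /= /existsP[x /andP[xY]]].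
  rewrite setCK => /existsP[y /andP[yY /eqP ->]].
  apply/existsP; exists y; rewrite yY; apply/existsP; exists x.
  by rewrite xY setUC eqxx.
by apply/eqP; rewrite eqEsubset sub -{1}[X]setCK sub.
Qed.

End Cut.

(** * Edge density and the largest Laplacian eigenvalue *)

Section Density.

Variables (R : rcfType) (T : finType) (e : rel T).
Hypothesis e_sym : symmetric e.
Variable X : {set T}.
Hypotheses (X_n0 : X != set0) (XC_n0 : ~: X != set0).

Let p : R := #|X|%:R.
Let q : R := #|~: X|%:R.
Let m : R := #|edge_boundary e X|%:R.
(* The values make f orthogonal to the constants; its Rayleigh quotient is the
   edge density. *)
Let f (v : T) : R := if v \in X then q else - p.

Let p_gt0 : 0 < p. Proof. by rewrite ltr0n card_gt0. Qed.
Let q_gt0 : 0 < q. Proof. by rewrite ltr0n card_gt0. Qed.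
Let cardTE : #|T|%:R = p + q :> R. Proof. by rewrite -(cardsC X) natrD. Qed.

Let sum_cut (g h : T -> R) :
  \sum_v (if v \in X then g v else h v) =
  \sum_(v in X) g v + \sum_(v in ~: X) h v.
Proof.
rewrite (bigID (mem X)) /=; congr (_ + _).
  by apply: eq_bigr => v ->.
by apply: eq_big => v; rewrite ?inE // => /negPf ->.
Qed.

Let lap_cut v : lap e f v =
  if v \in X then (p + q) * (degree_in e (~: X) v)%:R
  else - (p + q) * (degree_in e X v)%:R.
Proof.
rewrite /lap (bigID (mem X)) /= !degree_inE /f; case: ifP => vX.
  rewrite big1 ?add0r => [|w /andP[_ ->]]; last by rewrite subrr.
  rewrite mulr_sumr; apply: eq_big => w; first by rewrite inE andbC.
  by case/andP=> _ /negPf ->; ring.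
rewrite [X in _ + X]big1 ?addr0 => [|w /andP[_ /negPf ->]]; last by rewrite subrr.
rewrite mulr_sumr; apply: eq_big => w; first by rewrite andbC.
by case/andP=> _ ->; ring.
Qed.

Let boundaryE : \sum_(v in X) (degree_in e (~: X) v)%:R = m.
Proof. by rewrite /m card_edge_boundary // natr_sum. Qed.

Let boundaryCE : \sum_(v in ~: X) (degree_in e X v)%:R = m.
Proof. by rewrite /m -edge_boundaryC card_edge_boundary // setCK natr_sum. Qed.

Let cut_norm : \sum_v f v ^+ 2 = (p + q) * p * q.
Proof.
rewrite (eq_bigr (fun v => if v \in X then q ^+ 2 else (- p) ^+ 2)); last first.
  by move=> v _; rewrite /f; case: ifP.
rewrite sum_cut !sumr_const -[q ^+ 2 *+ _]mulr_natr -[(- p) ^+ 2 *+ _]mulr_natr.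
by rewrite -/p -/q; ring.
Qed.

Let cut_form : \sum_v f v * lap e f v = (p + q) ^+ 2 * m.
Proof.
rewrite (eq_bigr (fun v => if v \in X
    then q * (p + q) * (degree_in e (~: X) v)%:R
    else p * (p + q) * (degree_in e X v)%:R)); last first.
  by move=> v _; rewrite lap_cut /f; case: ifP => _; ring.
by rewrite sum_cut -!mulr_sumr boundaryE boundaryCE; ring.
Qed.

Let densityE : edge_density e R X * ((p + q) * p * q) = (p + q) ^+ 2 * m.
Proof.
rewrite /edge_density cardTE -/p -/q -/m; field.
by rewrite !gt_eqF.
Qed.

Lemma edge_density_le_mu1 : edge_density e R X <= mu e R 1.
Proof.
have [le_mu _] := mu1_rayleigh e_sym f.
rewrite -(ler_pM2r (_ : 0 < (p + q) * p * q)) ?mulr_gt0 ?addr_gt0 //.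
by rewrite densityE -cut_form -cut_norm.
Qed.

(** Equality makes the cut function an eigenfunction; at a vertex of X the
    eigenvalue equation reads n d = mu_1 q, where d is the number of neighbours
    outside X, so d is the same for all such vertices; likewise outside X. *)
Lemma edge_density_eq_mu1 : edge_density e R X = mu e R 1 ->
  exists s t : nat,
    [/\ forall v, v \in X -> degree_in e (~: X) v = s,
        forall v, v \in ~: X -> degree_in e X v = t
      & (s * #|X| = t * #|~: X|)%N].
Proof.
move=> eq_mu; have [_ eig] := mu1_rayleigh e_sym f.
have {}eig v : lap e f v = mu e R 1 * f v.
  by apply: eig; rewrite cut_norm cut_form -densityE eq_mu.
have n_gt0 : 0 < p + q by rewrite addr_gt0.
have /set0Pn[x xX] := X_n0; have /set0Pn[y yX] := XC_n0.
have degX v : v \in X -> degree_in e (~: X) v = degree_in e (~: X) x.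
  move=> vX; apply/eqP; rewrite -(eqr_nat R).
  have := eig v; have := eig x; rewrite !lap_cut /f vX xX => <-.
  by move/(mulfI (lt0r_neq0 n_gt0)) ->.
have degXC v : v \in ~: X -> degree_in e X v = degree_in e X y.
  move=> vX; apply/eqP; rewrite -(eqr_nat R).
  have := eig v; have := eig y; rewrite !lap_cut /f.
  move: vX yX; rewrite !inE => /negPf -> /negPf -> <-.
  by move/(mulfI _) -> => //; rewrite oppr_eq0 lt0r_neq0.
exists (degree_in e (~: X) x), (degree_in e X y); split=> //.
transitivity #|edge_boundary e X|.
  by rewrite card_edge_boundary // (eq_bigr _ degX) sum_nat_const mulnC.
rewrite -edge_boundaryC card_edge_boundary // setCK (eq_bigr _ degXC).
by rewrite sum_nat_const mulnC.
Qed.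

End Density.

(** * The structure of a dominating induced matching *)

Section DominatingInducedMatching.

Variables (T : finType) (e : rel T).
Hypotheses (e_sym : symmetric e) (e_irr : irreflexive e).
Variable N : {set {set T}}.
Hypothesis DIM_N : dominating_induced_matching e N.

Let X := cover N.

Lemma edgesP {f : {set T}} :
  reflect (exists x y, e x y /\ f = [set x; y]) (f \in edges e).
Proof.
rewrite inE; apply: (iffP existsP) => [[x /existsP[y /andP[exy /eqP ->]]]|].
  by exists x, y.
by move=> [x [y [exy ->]]]; exists x; apply/existsP; exists y; rewrite exy eqxx.
Qed.

Lemma card_cover_matching : #|X| = (2 * #|N|)%N.
Proof.
have [[_ /subsetP N_e tN] _] := DIM_N.
rewrite /X -(eqP tN) (eq_bigr (fun=> 2%N)) ?sum_nat_const 1?mulnC // => f /N_e.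
move/edgesP => [x [y [exy ->]]]; rewrite cards2.
by case: eqP exy => // ->; rewrite e_irr.
Qed.

(** The only neighbour of v in V(N) is its partner: an edge between the ends of two
    different edges of N would meet both of them. *)
Lemma degree_in_cover v : v \in X -> degree_in e X v = 1%N.
Proof.
have [[_ /subsetP N_e tN] dom] := DIM_N.
move=> vX; have vN := pblock_mem vX.
have v_vN : v \in pblock N v by rewrite mem_pblock.
have [w evw vNE] : exists2 w, e v w & pblock N v = [set v; w].
  have [x [y [exy xyE]]] := edgesP (N_e _ vN).
  move: v_vN; rewrite xyE !inE => /orP[] /eqP ->; first by exists y.
  by exists x; [rewrite e_sym | rewrite setUC].
have wX : w \in X by apply/bigcupP; exists (pblock N v) => //; rewrite vNE set22.
rewrite /degree_in -(cards1 w); apply: eq_card => u; rewrite !inE.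
apply/andP/eqP => [[uX evu]|-> //].
have uN := pblock_mem uX; have u_uN : u \in pblock N u by rewrite mem_pblock.
suff uv : pblock N u = pblock N v.
  move: u_uN; rewrite uv vNE !inE => /orP[] /eqP // uE.
  by rewrite uE e_irr in evu.
have vu_e : [set v; u] \in edges e by apply/edgesP; exists v, u.
have [vuN|/eqP/cards1P[g gE]] := dom _ vu_e.
  by rewrite !(def_pblock tN vuN) ?set21 ?set22.
have : pblock N v \in [set g].
  rewrite -gE !inE vN; apply/set0Pn; exists v; by rewrite inE v_vN set21.
have : pblock N u \in [set g].
  rewrite -gE !inE uN; apply/set0Pn; exists u; by rewrite inE u_uN set22.
by rewrite !inE => /eqP -> /eqP ->.
Qed.

(** An edge with both ends outside V(N) would meet no edge of N. *)
Lemma degree_in_coverC v : v \in ~: X -> degree_in e (~: X) v = 0%N.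
Proof.
have [_ dom] := DIM_N.
move=> vX; apply: eq_card0 => u; rewrite !inE; apply/negP => /andP[uX evu].
have vu_e : [set v; u] \in edges e by apply/edgesP; exists v, u.
have [g gN] : exists2 g, g \in N & [set v; u] :&: g != set0.
  have [vuN|/eqP/cards1P[g gE]] := dom _ vu_e.
    by exists [set v; u]; rewrite // setIid; apply/set0Pn; exists v; rewrite set21.
  have : g \in [set g] by rewrite set11.
  by rewrite -gE inE => /andP[]; exists g.
case/set0Pn => x; rewrite !inE => /andP[vux xg].
have xX : x \in X by apply/bigcupP; exists g.
case/orP: vux => /eqP xE; first by move: vX; rewrite inE -xE xX.
by move: uX; rewrite -xE xX.
Qed.

End DominatingInducedMatching.

(** * The Laplacian spread *)

Theorem corollary13 (R : rcfType) (T : finType) (e : rel T)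
    (e_sym : symmetric e) (e_irr : irreflexive e)
    (n k : nat) (N : {set {set T}})
    (cardT : #|T| = n) (cardN : #|N| = k)
    (DIM_N : dominating_induced_matching e N)
    (le_2k_n : (2 * k <= n - 1)%N)
    (* excludes exactly K_3, for which the inequality reads 0 >= 1 *)
    (not_complete : ~ complete e) :
  let X := cover N in
  laplacian_spread e R >= avg_degree e R X - 1
  /\ (laplacian_spread e R = avg_degree e R X - 1 ->
      (exists s t : nat,
         [/\ forall v, v \in X -> #|[set w in ~: X | e v w]| = s,
             forall v, v \in ~: X -> #|[set w in X | e v w]| = t
           & (s * #|X| = t * #|~: X|)%N])
      /\ edge_density e R X = mu e R 1
      /\ (n%:R - 2 * k%:R)^-1 * \sum_(v in ~: X) (deg e v)%:R
         = algebraic_connectivity e R).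
Proof.
move=> X.
have k_gt0 : (0 < k)%N by have [[N0 _ _] _] := DIM_N; rewrite -cardN card_gt0.
have cardX : #|X| = (2 * k)%N by rewrite /X (card_cover_matching e_irr DIM_N) cardN.
have cardXC : #|~: X| = (n - 2 * k)%N by rewrite cardsCs setCK cardT cardX.
have X_n0 : X != set0 by rewrite -card_gt0 cardX; lia.
have XC_n0 : ~: X != set0 by rewrite -card_gt0 cardXC; lia.
pose p : R := #|X|%:R; pose q : R := #|~: X|%:R.
pose m : R := #|edge_boundary e X|%:R.
have p_gt0 : 0 < p by rewrite ltr0n card_gt0.
have q_gt0 : 0 < q by rewrite ltr0n card_gt0.
have avgX : avg_degree e R X - 1 = m / p.
  rewrite /avg_degree -/p.
  have -> : \sum_(v in X) (deg e v)%:R = p + m.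
    rewrite /m card_edge_boundary // natr_sum /p -sumr_const -big_split /=.
    apply: eq_bigr => v vX; rewrite (deg_split _ X) natrD.
    by rewrite (degree_in_cover e_sym e_irr DIM_N vX).
  by field; rewrite gt_eqF.
have sumXC : \sum_(v in ~: X) (deg e v)%:R = m.
  rewrite /m -edge_boundaryC card_edge_boundary // setCK natr_sum.
  apply: eq_bigr => v vX; rewrite (deg_split _ X).
  by rewrite (degree_in_coverC DIM_N vX) addn0.
have density : edge_density e R X = m / p + m / q.
  rewrite /edge_density -(cardsC X) natrD -/p -/q -/m; field.
  by rewrite !gt_eqF.
have a_le : algebraic_connectivity e R <= m / q.
  rewrite ler_pdivlMr // -sumXC mulr_natr -sumr_const.
  by apply: ler_sum => v _; apply: algebraic_connectivity_le_deg.
have mu_ge := edge_density_le_mu1 R e_sym X_n0 XC_n0.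
rewrite /laplacian_spread avgX; split=> [|eq_spread]; first by lra.
have eq_mu : edge_density e R X = mu e R 1 by lra.
split; first exact: (edge_density_eq_mu1 e_sym X_n0 XC_n0 eq_mu).
split=> //; rewrite sumXC -natrM -natrB -?cardXC -/q; last by lia.
by lra.
Qed.
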